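(* Let $\mu_1$ and $\mu_2$ be ergodic invariant probability measures of the Markov chain $X$. Assume that there is a set $M\in\mathcal E\otimes\mathcal E$ with $(\mu_1\otimes\mu_2)(M)>0$ such that for each $(x,y)\in M$ there exists $\alpha_{x,y}>0$ such that for each $\varepsilon>0$ there exists $\xi^{\varepsilon}_{x,y}\in\widehat C(\mathbb P_x,\mathbb P_y)$ which satisfies $$\limsup_{n\to\infty}\frac1n\sum_{i=0}^{n-1}\xi^{\varepsilon}_{x,y}\big(d(X_i,Y_i)\le\varepsilon\big)\ge\alpha_{x,y}.$$ Then $\mu_1=\mu_2$.
   Context: Setting. $(E,\rho)$ is a Polish space ($\rho$ a complete separable metric, $\rho\le 1$) with Borel $\sigma$-algebra $\mathcal E$. $X=\{X_n,n\in\mathbb Z_+\}$ is a Markov chain with state space $(E,\mathcal E)$ and transition kernel $P(x,dy)$; $\mathbb P_\mu$ is the law of $X$ on $E^\infty:=E^{\mathbb Z_+}$ (with the product $\sigma$-algebra) when $X_0$ has law $\mu$, and $\mathbb P_x:=\mathbb P_{\delta_x}$. A probability measure $\mu$ on $E$ is invariant if $\mu(dy)=\int_E P(x,dy)\mu(dx)$; it is ergodic if the left shift on $E^\infty$ is ergodic with respect to $\mathbb P_\mu$. $d$ is a second metric on $E$, bounded and continuous with respect to $\rho$ (possibly $d=\rho$), not assumed complete. $\overline E^d$ is the completion of $E$ with respect to $d$, and it is assumed that for every $y\in E$ there are $d$-continuous functions $\rho^y_n:\overline E^d\to[0,\infty)$, $n\ge1$, with $\rho_n^y(x)\to\rho(x,y)$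 for $x\in E$ and $\rho_n^y(x)\to\infty$ for $x\in\overline E^d\setminus E$. Measurability refers to $\rho$. For probability measures $\mathbb P,\mathbb Q$ on $E^\infty$, $\widehat C(\mathbb P,\mathbb Q)$ is the set of probability measures $\xi$ on $E^\infty\times E^\infty$ whose marginals satisfy $\pi_1(\xi)\ll\mathbb P$ and $\pi_2(\xi)\ll\mathbb Q$ (generalized couplings). Under such $\xi$, $(X_n)_{n\ge0}$ and $(Y_n)_{n\ge0}$ denote the first and second coordinate sequences on $E^\infty\times E^\infty$. *)

(* Defs.v *)
From HB Require Import structures.
From mathcomp Require Import all_boot all_order all_algebra.
From mathcomp Require Import all_classical all_reals all_analysis.

Set Implicit Arguments.
Unset Strict Implicit.
Unset Printing Implicit Defensive.

Import Order.TTheory GRing.Theory Num.Theory.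
Import numFieldNormedType.Exports.

Local Open Scope classical_set_scope.
Local Open Scope ring_scope.
Local Open Scope ereal_scope.

(* Complete metric spaces.  As everywhere in the library, completeness and
   measurability come with a distinguished point, i.e. the space is nonempty. *)
#[short(type="completeMetricType")]
HB.structure Definition CompleteMetric (K : numDomainType) :=
  { T of Metric K T & Complete T }.

Definition separable_space (T : topologicalType) : Prop :=
  exists2 D : set T, countable D & dense D.

(* The measurable space (E, Borel sigma-algebra); same carrier as E. *)
Notation borel E := (g_sigma_algebraType (@open E)).

Definition is_metric (R : realType) (E : Type) (d : E -> E -> R) : Prop :=
  [/\ forall x, d x x = 0%R,
      forall x y, d x y = 0%R -> x = y,
      forall x y, d x y = d y x &
      forall x y z, (d x z <= d x y + d y z)%R].

(* [Ebar], with the embedding [iota], is a completion of the metric space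
   (E, d); it is unique up to isometry. *)
Definition is_completion (R : realType) (E : Type) (d : E -> E -> R)
    (Ebar : completeMetricType R) (iota : E -> Ebar) : Prop :=
  (forall x y, mdist (iota x) (iota y) = d x y) /\ dense (range iota).

(* For every y in E, the function equal to rho(., y) on E and to +oo on
   Ebar \ E is a pointwise limit of nonnegative d-continuous functions. *)
Definition approximable_metric (R : realType) (E Ebar : metricType R)
    (iota : E -> Ebar) : Prop :=
  forall y : E, exists f : nat -> Ebar -> R,
    [/\ forall n, continuous (f n),
        forall n z, (0 <= f n z)%R,
        forall x : E, f n (iota x) @[n --> \oo] --> (mdist x y : R) &
        forall z : Ebar, ~ range iota z -> f n z @[n --> \oo] --> +oo%R].

Section paths.
Context (d : measure_display) (T : measurableType d).

Definition coord_events (i : nat) : set (set (nat -> T)) :=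
  preimage_set_system setT (fun w : nat -> T => w i) measurable.

Definition path_space : measurableType _ :=
  g_sigma_algebraType (\bigcup_i coord_events i).

(* sigma(X_0, ..., X_n) *)
Definition past (n : nat) : set (set path_space) :=
  <<s \bigcup_(i in [set i | (i <= n)%N]) coord_events i >>.

Definition path_shift (w : path_space) : path_space := fun n => w n.+1.

End paths.
Arguments past {d} T n.

Section chain.
Context (d : measure_display) (T : measurableType d) (R : realType).
Variable P : R.-pker T ~> T.

(* [Q] is the law on the path space of the Markov chain with kernel [P] and
   initial law [mu].  Such a [Q] exists by Ionescu-Tulcea, and it is unique on
   measurable sets, so "there is Q with [chain_law mu Q] and ..." is a
   statement about the law P_mu. *)
Definition chain_law (mu : probability T R) (Q : probability (path_space T) R)
    : Prop :=
  (forall A, measurable A -> Q [set w | A (w 0%N)] = mu A) /\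
  (forall n (B : set (path_space T)) A, past T n B -> measurable A ->
     Q (B `&` [set w | A (w n.+1)]) = \int[Q]_(w in B) P (w n) A).

Definition invariant_measure (mu : probability T R) : Prop :=
  forall A, measurable A -> mu A = \int[mu]_x P x A.

Definition shift_ergodic (Q : probability (path_space T) R) : Prop :=
  forall A : set (path_space T), measurable A -> @path_shift _ T @^-1` A = A ->
    Q A = 0 \/ Q A = 1.

Definition ergodic_measure (mu : probability T R) : Prop :=
  exists2 Q, chain_law mu Q & shift_ergodic Q.

End chain.

Definition gen_coupling (d : measure_display) (S : measurableType d)
    (R : realType) (P1 P2 : probability S R)
    (xi : probability (S * S)%type R) : Prop :=
  pushforward xi fst `<< P1 /\ pushforward xi snd `<< P2.

(* Main.v *)
Require Import Defs.
From HB Require Import structures.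
From mathcomp Require Import all_boot all_order all_algebra.
From mathcomp Require Import all_classical all_reals all_analysis.
From mathcomp Require Import measurable_realfun ring lra.

Set Implicit Arguments.
Unset Strict Implicit.
Unset Printing Implicit Defensive.

Import Order.TTheory GRing.Theory Num.Theory.
Import numFieldNormedType.Exports.

Local Open Scope classical_set_scope.
Local Open Scope ring_scope.
Local Open Scope ereal_scope.

(* Two distinct ergodic measures are mutually singular, so there is [D] with
   mu1 (~` D) = mu2 D = 0.  For the finite measure mu1 + mu2 the set [D] can be
   approximated from inside by [K1], and its complement by [K2], at positive
   [d]-distance [delta], up to mass [lam].  A maximal inequality and ergodicity
   show that for mu1-almost every x, almost surely under P_x, the fraction of time
   spent outside [K1] is asymptotically at most [lam]; an absolutely continuous
   change of the law preserves this, and similarly for mu2, P_y and [K2].  Under a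
   generalized coupling of P_x and P_y, being [delta / 2]-close at time [i] requires
   X_i outside [K1] or Y_i outside [K2], hence happens with frequency O(lam), which
   contradicts the lower bound [alpha] once [lam] is small compared to it.  The point
   (x, y), and hence [alpha], must be fixed before [lam]: the almost sure statements
   are therefore taken simultaneously for lam = 1 / (k + 1), k in nat. *)

(** Bundling makes [pushforward Q (mfun_of mf)] a measure, so that laws of coordinates and of
    shifted paths can be integrated against. *)
Definition mfun_of (d1 d2 : measure_display) (S1 : measurableType d1)
    (S2 : measurableType d2) (f : S1 -> S2) (mf : measurable_fun setT f) :
  {mfun S1 >-> S2} := HB.pack f (isMeasurableFun.Build _ _ _ _ _ mf).

(** * Measurability on the path space and the Markov property for integrals *)

Section path_measurability.
Context (d : measure_display) (T : measurableType d).

Lemma measurable_coord i : measurable_fun setT (fun w : path_space T => w i).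
Proof.
move=> _ A mA; apply: sub_sigma_algebra; exists i => //; exists A => //.
Qed.

Lemma measurable_coord_preimage i (A : set T) : measurable A ->
  measurable [set w : path_space T | A (w i)].
Proof. by move=> mA; rewrite -[X in measurable X]setTI; exact: measurable_coord. Qed.

Lemma past_measurable n (B : set (path_space T)) : past T n B -> measurable B.
Proof.
move: B; apply: smallest_sub; first exact: sigma_algebra_measurable.
by move=> C [i _ Ci]; apply: sub_sigma_algebra; exists i.
Qed.

Lemma past_coord n i (A : set T) : (i <= n)%N -> measurable A ->
  past T n [set w | A (w i)].
Proof.
move=> lin mA; apply: sub_sigma_algebra; exists i => //.
by exists A => //; rewrite setTI.
Qed.

Lemma past_le m n (B : set (path_space T)) : (m <= n)%N ->
  past T m B -> past T n B.
Proof.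
move=> mn; move: B; apply: sub_smallest2r; first exact: smallest_sigma_algebra.
by move=> C [i /= im Ci]; exists i => //=; exact: leq_trans im mn.
Qed.

Lemma pastI n (B C : set (path_space T)) :
  past T n B -> past T n C -> past T n (B `&` C).
Proof.
move=> nB nC; exact: (@measurableI _ (g_sigma_algebraType _)).
Qed.

Lemma measurable_path_shift : measurable_fun setT (@path_shift _ T).
Proof.
have gen : @measurable _ (path_space T) = <<s \bigcup_i coord_events (T:=T) i >> by [].
apply: (measurability _ gen).
move=> _ [_ [i _ [A mA <-]] <-]; rewrite !setTI.
exact: (measurable_coord_preimage i.+1 mA).
Qed.

End path_measurability.

Section chain_law_theory.
Context (d : measure_display) (T : measurableType d) (R : realType).
Variable P : R.-pker T ~> T.

Lemma measurable_kernel_integral (g : T -> \bar R) : (forall x, 0 <= g x) ->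
  measurable_fun setT g -> measurable_fun setT (fun x => \int[P x]_y g y).
Proof.
move=> g0 mg; apply: measurable_fun_integral_kernel => //.
by move=> U mU; exact: measurable_kernel.
Qed.

Import HBNNSimple.

(** [chain_law] gives the case of an indicator [g]. Simple functions follow by linearity over their
    level sets, and general [g] by monotone convergence, used in the outer and in the inner
    integral. *)
Lemma chain_law_integral mu (Q : probability (path_space T) R) n
    (B : set (path_space T)) (g : T -> \bar R) :
  chain_law P mu Q -> past T n B -> (forall x, 0 <= g x) ->
  measurable_fun setT g ->
  \int[Q]_(w in B) g (w n.+1) = \int[Q]_(w in B) \int[P (w n)]_y g y.
Proof.
move=> [_ PQ] nB g0 mg; have mB := past_measurable nB.
have mc i : measurable_fun B (fun w : path_space T => w i).
  by apply: measurable_funTS; exact: measurable_coord.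
have mPA A : measurable A ->
    measurable_fun B (fun w : path_space T => P (w n) A).
  by move=> mA; exact: (measurableT_comp (measurable_kernel P A mA) (mc n)).
pose f_ := nnsfun_approx measurableT mg.
have mf_ k i : measurable_fun B (fun w : path_space T => (f_ k (w i))%:E).
  by apply/measurable_EFinP; apply: measurableT_comp => //; exact: mc.
have simp k : \int[Q]_(w in B) (f_ k (w n.+1))%:E =
    \int[Q]_(w in B) \int[P (w n)]_y (f_ k y)%:E.
  pose F r := f_ k @^-1` [set r].
  have mF r : measurable (F r) by exact: measurable_sfunP.
  transitivity (\sum_(r \in range (f_ k)) r%:E * Q (B `&` [set w | F r (w n.+1)])).
    under eq_integral do rewrite fimfunE -fsumEFin//.
    rewrite ge0_integral_fsum//; last 2 first.
    - move=> r; apply/measurable_EFinP; apply: measurable_funM => //.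
      by apply: measurableT_comp => //; exact: mc.
    - by move=> r z _; rewrite EFinM nnfun_muleindic_ge0.
    apply: eq_fsbigr => r _.
    have -> : (fun x : path_space T => (r * \1_(f_ k @^-1` [set r]) (x n.+1))%:E)
       = (fun x => (r * \1_[set w : path_space T | F r (w n.+1)] x)%:E).
      by [].
    rewrite (integralZl_indic mB (fun r => [set w : path_space T | F r (w n.+1)]))//.
    - rewrite integral_indic//; last exact: measurable_coord_preimage.
      by rewrite setIC.
    - by move=> r0; apply/seteqP; split=> // w; rewrite /F preimage_nnfun0.
    - exact: measurable_coord_preimage.
  under [in RHS]eq_integral.
    move=> w _; under eq_integral do rewrite fimfunE -fsumEFin//.
    rewrite ge0_integral_fsum//; last 2 first.
    - by move=> r; exact/measurable_EFinP/measurableT_comp.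
    - by move=> r z _; rewrite EFinM nnfun_muleindic_ge0.
    under eq_fsbigr.
      move=> r _.
      rewrite (integralZl_indic _ (fun r => f_ k @^-1` [set r]))//; last first.
        by move=> r0; rewrite preimage_nnfun0.
      rewrite integral_indic// setIT.
      over.
    over.
  rewrite ge0_integral_fsum//; last 2 first.
  - by move=> r; apply: measurable_funeM; exact: mPA.
  - move=> r w _; have [r0|r0] := leP 0%R r; first by rewrite mule_ge0.
    by rewrite preimage_nnfun0// measure0 mule0.
  apply: eq_fsbigr => r _.
  have [r0|r0] := leP 0%R r.
    rewrite ge0_integralZl//; last exact: mPA.
    by rewrite PQ.
  (* A negative [r] is not a value of the nonnegative function [f_ k]: its level set is empty and
     both sides vanish. *)
  rewrite [in LHS](_ : [set w | _] = set0).
    rewrite setI0 measure0 mule0 integral0_eq// => w _.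
    by rewrite preimage_nnfun0// measure0 mule0.
  by apply/seteqP; split=> // w; rewrite /F preimage_nnfun0.
have cvgf x : (f_ k x)%:E @[k --> \oo] --> g x by exact: cvg_nnsfun_approx.
have ndf x : {homo (fun k => (f_ k x)%:E) : a b / (a <= b)%N >-> a <= b}.
  by move=> a b ab; rewrite lee_fin; exact/lefP/nd_nnsfun_approx.
have L : \int[Q]_(w in B) (f_ k (w n.+1))%:E @[k --> \oo] -->
    \int[Q]_(w in B) g (w n.+1).
  rewrite [X in _ --> X](_ : _ = \int[Q]_(w in B) limn (fun k => (f_ k (w n.+1))%:E)).
    apply: cvg_monotone_convergence => //.
    by move=> k w _; rewrite lee_fin.
  by apply: eq_integral => w _; apply/esym/cvg_lim => //; exact: cvgf.
rewrite -(cvg_lim _ L)//.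
under eq_fun do rewrite simp.
rewrite -monotone_convergence//.
- apply: eq_integral => w _; rewrite -monotone_convergence//.
  + by apply: eq_integral => x _; apply/cvg_lim => //; exact: cvgf.
  + by move=> k; exact/measurable_EFinP.
  + by move=> k x _; rewrite lee_fin.
- move=> k.
  have f0 x : 0 <= (f_ k x)%:E by rewrite lee_fin.
  have mfk : measurable_fun setT (fun x => (f_ k x)%:E) by exact/measurable_EFinP.
  exact: (measurableT_comp (measurable_kernel_integral f0 mfk) (mc n)).
- by move=> k w _; apply: integral_ge0 => x _; rewrite lee_fin.
- move=> w _ a b ab; apply: ge0_le_integral => //.
  + by move=> x _; rewrite lee_fin.
  + exact/measurable_EFinP.
  + exact/measurable_EFinP.
  + by move=> x _; exact: ndf.
Qed.

End chain_law_theory.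

(** * Cylinder probabilities *)

Definition cylinder (T : Type) (A : nat -> set T) : set (nat -> T) :=
  [set w | forall i, A i (w i)].

(** These sets form a pi-system generating the sigma-algebra of the path space; the bound [N] allows
    their probabilities to be computed by recursion. *)
Definition finite_cylinders (d : measure_display) (T : measurableType d) :
    set (set (path_space T)) :=
  [set C | exists (N : nat) (A : nat -> set T),
    [/\ forall i, measurable (A i), forall i, (N <= i)%N -> A i = setT &
        C = cylinder A]].
Arguments finite_cylinders {d} T.

Section finite_cylinders_theory.
Context (d : measure_display) (T : measurableType d).

Lemma measurable_cylinder (A : nat -> set T) : (forall i, measurable (A i)) ->
  measurable (cylinder A : set (path_space T)).
Proof.
move=> mA; rewrite (_ : cylinder A = \bigcap_i [set w : path_space T | A i (w i)]).
  by apply: bigcapT_measurable => i; exact: measurable_coord_preimage.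
by apply/seteqP; split=> [w Aw i _|w Aw i]; exact: Aw.
Qed.

Lemma finite_cylinders_setI_closed : setI_closed (finite_cylinders T).
Proof.
move=> _ _ [N [A [mA AT ->]]] [M [B [mB BT ->]]].
exists (maxn N M), (fun i => A i `&` B i); split.
- by move=> i; exact: measurableI.
- by move=> i; rewrite geq_max => /andP[/AT -> /BT ->]; rewrite setTI.
- apply/seteqP; split=> [w [Aw Bw] i|w ABw]; first by split; [exact: Aw|exact: Bw].
  by split=> i; have [] := ABw i.
Qed.

Lemma finite_cylindersT : finite_cylinders T setT.
Proof.
by exists 0%N, (fun=> setT); split=> //; apply/seteqP; split.
Qed.

Lemma finite_cylinders_generate :
  @measurable _ (path_space T) = <<s finite_cylinders T >>.
Proof.
apply/seteqP; split.
- apply: smallest_sub; first exact: smallest_sigma_algebra.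
  move=> _ [i _ [A mA <-]]; apply: sub_sigma_algebra.
  exists i.+1, (fun j => if j == i then A else setT); split.
  + by move=> j; case: ifP.
  + by move=> j ij; rewrite gtn_eqF.
  + rewrite setTI; apply/seteqP; split=> [w Aw j|w /(_ i)]; last by rewrite eqxx.
    by case: ifPn => // /eqP ->.
- apply: smallest_sub; first exact: sigma_algebra_measurable.
  by move=> _ [N [A [mA _ ->]]]; exact: measurable_cylinder.
Qed.

End finite_cylinders_theory.

Section cylinder_law.
Context (d : measure_display) (T : measurableType d) (R : realType).
Variable P : R.-pker T ~> T.

(** The probability that the chain started at [x] has X_i in [A i] for all i < N, written as an
    iterated kernel integral so that it makes sense without a law P_x. *)
Fixpoint stay_prob (N : nat) (A : nat -> set T) (x : T) : \bar R :=
  if N is N'.+1 then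
    (\1_(A 0%N) x)%:E * \int[P x]_y stay_prob N' (fun i => A i.+1) y
  else 1.

Lemma stay_prob_ge0 N A x : 0 <= stay_prob N A x.
Proof.
elim: N A x => //= N IH A x.
by rewrite mule_ge0 ?lee_fin// integral_ge0.
Qed.

Lemma measurable_stay_prob N A : (forall i, measurable (A i)) ->
  measurable_fun setT (stay_prob N A).
Proof.
elim: N A => [A mA|N IH A mA] /=; first exact: measurable_cst.
apply: emeasurable_funM; first exact/measurable_EFinP.
apply: measurable_kernel_integral; last exact: IH.
by move=> x; exact: stay_prob_ge0.
Qed.

Lemma stay_prob_integral (dS : measure_display) (S : measurableType dS)
    (Q : {measure set S -> \bar R}) (X : S -> T) (B : set S) N A :
  \int[Q]_(w in B) stay_prob N.+1 A (X w) =
  \int[Q]_(w in B `&` X @^-1` A 0%N)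
    \int[P (X w)]_y stay_prob N (fun i => A i.+1) y.
Proof.
rewrite integral_mkcondr; apply: eq_integral => w _ /=.
rewrite patchE indicE -[w \in _]/(X w \in A 0%N); case: ifP => [Aw|nAw].
  by rewrite mul1e.
by rewrite mul0e.
Qed.

(** Induction on [N]: the Markov property turns the outer kernel integral into a function of
    X_(n+1), and the condition that X_(n+1) lies in [A 0] is absorbed into the past event. This is
    why [n] and [B] vary in the induction. *)
Lemma chain_law_after mu (Q : probability (path_space T) R) N A n
    (B : set (path_space T)) :
  chain_law P mu Q -> (forall i, measurable (A i)) ->
  (forall i, (N <= i)%N -> A i = setT) -> past T n B ->
  Q (B `&` [set w | forall i, A i (w (n.+1 + i)%N)]) =
  \int[Q]_(w in B) \int[P (w n)]_y stay_prob N A y.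
Proof.
move=> PQ; elim: N A n B => [|N IH] A n B mA AT nB; have mB := past_measurable nB.
  rewrite (_ : [set w : path_space T | _] = setT); last first.
    by apply/seteqP; split=> // w _ i; rewrite AT.
  rewrite setIT /=; under eq_integral do rewrite integral_cst// mul1e prob_kernel.
  by rewrite integral_cst// mul1e.
rewrite -(chain_law_integral PQ nB); last 2 first.
- by move=> x; exact: stay_prob_ge0.
- exact: measurable_stay_prob.
rewrite (stay_prob_integral Q (fun w : path_space T => w n.+1)) -IH//.
- congr (Q _); rewrite -setIA; congr (_ `&` _).
  apply/seteqP; split=> [w Aw|w [A0 Aw] i].
    split; first by have := Aw 0%N; rewrite addn0.
    by move=> i /=; have := Aw i.+1; rewrite addnS addSn.
  by case: i => [|i]; [rewrite addn0|have := Aw i; rewrite addnS addSn].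
- by move=> i Ni; exact: AT.
- apply: pastI; first exact: past_le nB.
  exact: past_coord.
Qed.

Lemma chain_law_init_integral mu (Q : probability (path_space T) R)
    (B : set T) (g : T -> \bar R) :
  chain_law P mu Q -> measurable B -> (forall x, 0 <= g x) ->
  measurable_fun setT g ->
  \int[Q]_(w in [set w | B (w 0%N)]) g (w 0%N) = \int[mu]_(x in B) g x.
Proof.
move=> [Q0 _] mB g0 mg.
pose X0 := mfun_of (@measurable_coord _ T 0).
transitivity (\int[pushforward Q X0]_(x in B) g x).
  by rewrite (ge0_integral_pushforward (measurable_coord 0))//; exact: measurable_funTS.
by apply: eq_measure_integral => C mC _; exact: Q0.
Qed.

Lemma chain_law_cylinder mu (Q : probability (path_space T) R) N A (B : set T) :
  chain_law P mu Q -> (forall i, measurable (A i)) ->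
  (forall i, (N < i)%N -> A i = setT) -> measurable B ->
  Q (cylinder A `&` [set w | B (w 0%N)]) = \int[mu]_(x in B) stay_prob N.+1 A x.
Proof.
move=> PQ mA AT mB.
rewrite -(chain_law_init_integral PQ mB); last 2 first.
- by move=> x; exact: stay_prob_ge0.
- exact: measurable_stay_prob.
rewrite (stay_prob_integral Q (fun w : path_space T => w 0%N)).
(* The conditions [B] and [A 0] on X_0 form the past event at time 0; the sides from [A 1] on
   concern the later times. *)
rewrite -(chain_law_after (n := 0) PQ)//; last 2 first.
- by move=> i Ni; exact: AT.
- by apply: pastI; exact: past_coord.
congr (Q _); apply/seteqP; split=> [w [Aw Bw0]|w [[Bw0 Aw0] Aw]].
  by split; [split=> //; exact: Aw|move=> i; rewrite /= add1n; exact: Aw].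
by split=> //; case.
Qed.

End cylinder_law.

(** * Probabilities of path events as functions of the initial state *)

Section fiber_density.
Context (d : measure_display) (T : measurableType d) (R : realType).

(** On the set where [h] exceeds 1, the hypothesis forces the integral of the nonnegative function
    [h - 1] to be at most 0, so this function vanishes almost everywhere there. *)
Lemma density_le1 (mu : probability T R) (h : T -> \bar R) :
  (forall x, 0 <= h x) -> measurable_fun setT h ->
  (forall B, measurable B -> \int[mu]_(x in B) h x <= mu B) ->
  {ae mu, forall x, h x <= 1}.
Proof.
move=> h0 mh hmu.
pose D := [set x | 1 < h x].
have mD : measurable D.
  by rewrite -[D]setTI; apply: emeasurable_fun_o_infty.
have mhD : measurable_fun D (fun x => h x - 1).
  by apply: emeasurable_funB; [exact: measurable_funTS|exact: measurable_cst].
have h1 x : D x -> 0 <= h x - 1 by move=> /ltW; rewrite leeBrDr// add0e.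
have split_h : \int[mu]_(x in D) h x = \int[mu]_(x in D) (h x - 1) + mu D.
  rewrite -[X in _ + X]mul1e -integral_cst// -ge0_integralD//.
  by apply: eq_integral => x _; rewrite subeK.
have int0 : \int[mu]_(x in D) `|h x - 1| = 0.
  rewrite (eq_integral (fun x => h x - 1)); last first.
    by move=> x; rewrite inE => Dx; rewrite gee0_abs// h1.
  apply/eqP; rewrite eq_le integral_ge0// andbT.
  have := hmu D mD; rewrite split_h -[leRHS]add0e leeD2rE//.
  exact: fin_num_measure.
have /(ae_eq_integral_abs mu mD mhD) := int0.
apply: filterS => x Dx; rewrite leNgt; apply/negP => hx.
have hx1 : h x = 1 by rewrite -[LHS](@subeK _ _ 1)// (Dx hx) add0e.
by move: hx; rewrite hx1 ltxx.
Qed.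

Variable P : R.-pker T ~> T.

(* [h] plays the role of [x |-> P_x (G)]; the laws P_x themselves need not be
   constructed. *)
Definition fiber_density (G : set (path_space T)) (h : T -> \bar R) : Prop :=
  [/\ forall x, 0 <= h x, measurable_fun setT h &
   forall mu (Q : probability (path_space T) R) (B : set T), chain_law P mu Q -> measurable B ->
     Q (G `&` [set w | B (w 0%N)]) = \int[mu]_(x in B) h x].

(** The truncation at 1 keeps the new density finite and nonnegative at every point. By
    [density_le1] it alters [h] only on a [mu]-null set, for each initial law [mu] of a chain, and
    so changes no integral. *)
Lemma fiber_densityC G h : measurable G -> fiber_density G h ->
  fiber_density (~` G) (fun x => 1 - mine (h x) 1).
Proof.
move=> mG [h0 mh hG].
have k1 x : mine (h x) 1 <= 1 by rewrite ge_min lexx orbT.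
have k0 x : 0 <= mine (h x) 1 by rewrite le_min h0 lee01.
have kfin x : mine (h x) 1 \is a fin_num.
  by rewrite ge0_fin_numE// (le_lt_trans (k1 x))// ltry.
have mk : measurable_fun setT (fun x => mine (h x) 1).
  by apply: measurable_mine => //; exact: measurable_cst.
have mk' : measurable_fun setT (fun x => 1 - mine (h x) 1).
  by apply: emeasurable_funB => //; exact: measurable_cst.
split=> // [x|mu Q B PQ mB]; first by rewrite sube_ge0// kfin.
have mB0 := measurable_coord_preimage 0 mB.
have QB : Q [set w | B (w 0%N)] = mu B by case: PQ => ->.
have hB : Q (G `&` [set w | B (w 0%N)]) = \int[mu]_(x in B) mine (h x) 1.
  rewrite (hG _ _ _ PQ mB); apply: ge0_ae_eq_integral => //.
  - exact: measurable_funTS.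
  - exact: measurable_funTS.
  - have : {ae mu, forall x, h x <= 1}.
      apply: density_le1 => // C mC; rewrite -(hG _ _ _ PQ mC).
      have [<- // _] := PQ; apply: le_measure; rewrite ?inE//.
      + by apply: measurableI => //; exact: measurable_coord_preimage.
      + exact: measurable_coord_preimage.
    by apply: filterS => x hx1 _; rewrite min_l.
have tot : \int[mu]_(x in B) (1 - mine (h x) 1) + Q (G `&` [set w | B (w 0%N)]) = mu B.
  rewrite hB -ge0_integralD//.
  - under eq_integral do rewrite subeK//.
    by rewrite integral_cst// mul1e.
  - by move=> x _; rewrite sube_ge0// kfin.
  - exact: measurable_funTS.
  - exact: measurable_funTS.
have fin : Q (G `&` [set w | B (w 0%N)]) \is a fin_num.
  by apply: fin_num_measure; exact: measurableI.
rewrite -[RHS](addeK _ fin) tot -QB (measureDI Q mB0 mG).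
by rewrite (setIC _ G) addeK// setDE setIC.
Qed.

Lemma fiber_density_bigcup (F : (set (path_space T))^nat) h :
  (forall n, measurable (F n)) -> trivIset setT F ->
  (forall n, fiber_density (F n) (h n)) ->
  fiber_density (\bigcup_n F n) (fun x => \sum_(n <oo) h n x).
Proof.
move=> mF tF hF.
have h0 n x : 0 <= h n x by case: (hF n).
have mh n : measurable_fun setT (h n) by case: (hF n).
split=> [x| |mu Q B PQ mB]; first exact: nneseries_ge0.
  exact: ge0_emeasurable_sum.
have mB0 := measurable_coord_preimage 0 mB.
rewrite setI_bigcupl integral_nneseries//; last first.
  by move=> n; exact: measurable_funTS.
rewrite measure_bigcup//=.
- rewrite (@eq_eseriesl _ _ xpredT); last by move=> n; rewrite in_setT.
  by apply: eq_eseriesr => n _; case: (hF n) => _ _ /(_ _ _ _ PQ mB).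
- by move=> n _; exact: measurableI.
- exact: trivIset_setIr.
Qed.

(** The events with a fiber density form a Dynkin class, and [stay_prob] provides one for every
    finite cylinder; the pi-lambda theorem concludes. *)
Lemma fiber_density_exists (G : set (path_space T)) : measurable G ->
  exists h, fiber_density G h.
Proof.
move=> mG.
have mgen := finite_cylinders_generate T.
apply: (@dynkin_induction _ (path_space T) (finite_cylinders T)
  (fun G => exists h, fiber_density G h) mgen (@finite_cylinders_setI_closed _ T)).
- exists (cst 1); split=> [x| |mu Q B [PQ _] mB]; [exact: lee01|exact: measurable_cst|].
  by rewrite setTI PQ// integral_cst// mul1e.
- move=> _ [N [A [mA AT ->]]]; exists (stay_prob P N.+1 A); split.
  + by move=> x; exact: stay_prob_ge0.
  + exact: measurable_stay_prob.
  + move=> mu Q B PQ mB; apply: chain_law_cylinder => // i /ltnW; exact: AT.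
- by move=> S mS [h hS]; eexists; exact: fiber_densityC hS.
- by move=> F mF tF /choice[h hF]; eexists; exact: fiber_density_bigcup hF.
- by rewrite -mgen.
Qed.

(* Applied to Dirac masses, [fiber_density] identifies [h x] with [Px G]. *)
Lemma chain_law_null mu (Q : probability (path_space T) R) (G : set (path_space T)) :
  chain_law P mu Q -> measurable G -> Q G = 0 ->
  exists N, [/\ measurable N, mu N = 0 & forall x Px, chain_law P \d_x Px ->
    ~ N x -> Px G = 0].
Proof.
move=> PQ mG QG0; have [h [h0 mh hG]] := fiber_density_exists mG.
have h_int (nu : probability T R) (Q' : probability (path_space T) R) : chain_law P nu Q' -> Q' G = \int[nu]_x h x.
  by move=> /hG/(_ measurableT); rewrite setIT.
have mN : measurable [set x | 0 < h x].
  by rewrite -[X in measurable X]setTI; exact: emeasurable_fun_o_infty.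
exists [set x | 0 < h x]; split=> //.
- have : \int[mu]_x `|h x| = 0.
    by rewrite (eq_integral h) -?(h_int _ _ PQ)// => x _; rewrite gee0_abs.
  move=> /(ae_eq_integral_abs mu measurableT mh)[M [mM M0 hM]].
  apply: (subset_measure0 mN mM _ M0) => x /= hx; apply: hM => /(_ I) hx0.
  by move: hx; rewrite hx0 ltxx.
- move=> x Px PPx /negP; rewrite -leNgt => hx.
  rewrite (h_int _ _ PPx) integral_dirac// diracT mul1e.
  by apply/eqP; rewrite eq_le hx h0.
Qed.

End fiber_density.

(** * Frequencies of visits under an ergodic law *)

Section stationarity.
Context (d : measure_display) (T : measurableType d) (R : realType).
Variable P : R.-pker T ~> T.

(** By uniqueness of measures on a pi-system it suffices to compare finite cylinders. Both
    probabilities are integrals of [stay_prob], against the law of X_1 and that of X_0, and these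
    laws agree by invariance. *)
Lemma chain_law_stationary mu (Q : probability (path_space T) R) (G : set (path_space T)) :
  invariant_measure P mu -> chain_law P mu Q -> measurable G ->
  Q (@path_shift _ T @^-1` G) = Q G.
Proof.
move=> inv PQ.
pose sh := mfun_of (@measurable_path_shift _ T).
apply: (@measure_unique _ R (path_space T) (finite_cylinders T) (fun=> setT) _ _ _ _ (pushforward Q sh) Q).
- exact: finite_cylinders_generate.
- exact: finite_cylinders_setI_closed.
- by move=> _; exact: finite_cylindersT.
- by rewrite bigcup_const.
- move=> _ [N [A [mA AT ->]]].
  pose X1 := mfun_of (@measurable_coord _ T 1).
  have Q1 (B : set T) : measurable B -> pushforward Q X1 B = mu B.
    move=> mB; rewrite inv// -(chain_law_init_integral PQ measurableT); last 2 first.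
    + by [].
    + exact: measurable_kernel.
    have [_ /(_ 0%N setT B)] := PQ; rewrite setTI; apply => //.
    by rewrite (_ : setT = [set w : path_space T | setT (w 0%N)])//; exact: past_coord.
  have pT : past T 0 setT.
    by rewrite (_ : setT = [set w : path_space T | setT (w 0%N)])//; exact: past_coord.
  have AT' i : (N < i)%N -> A i = setT by move=> /ltnW; exact: AT.
  have after := chain_law_after PQ mA AT' pT.
  rewrite -(chain_law_integral PQ pT) in after; last 2 first.
  + by move=> x; exact: stay_prob_ge0.
  + exact: measurable_stay_prob.
  have init := chain_law_cylinder PQ mA AT' measurableT.
  rewrite setIT in init; rewrite setTI in after.
  apply: (etrans _ (esym init)); apply: (etrans after).
  transitivity (\int[pushforward Q X1]_x stay_prob P N.+1 A x).
    rewrite (ge0_integral_pushforward (measurable_coord 1))//.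
    * exact: measurable_stay_prob.
    * by move=> x _; exact: stay_prob_ge0.
  by apply: eq_measure_integral => B mB _; exact: Q1.
- by move=> _; rewrite /= /pushforward preimage_setT probability_setT ltry.
Qed.

End stationarity.

Section visits.
Context (d : measure_display) (T : measurableType d) (R : realType).
Implicit Types (A : set T) (c : R) (w : path_space T).
Local Open Scope ring_scope.

Definition visits A n w : R := \sum_(i < n) \1_A (w i).

(* [visits A n w - c * n] is unbounded in [n].  Unlike the set where it is positive
   infinitely often, this set is exactly invariant under the shift. *)
Definition excess A c : set (path_space T) :=
  [set w | forall k : nat, exists n, c * n%:R + k%:R < visits A n w].

Lemma visitsS A n w : visits A n.+1 w = \1_A (w 0%N) + visits A n (path_shift w).
Proof. by rewrite /visits big_ord_recl. Qed.

Lemma visits_ge0 A n w : 0 <= visits A n w.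
Proof. by apply: sumr_ge0. Qed.

Lemma visitsC A n w : visits (~` A) n w = n%:R - visits A n w.
Proof.
apply/eqP; rewrite eq_sym subr_eq; apply/eqP; rewrite /visits -big_split/=.
rewrite (eq_bigr (fun=> 1)) ?sumr_const ?card_ord// => i _.
by rewrite !indicE in_setC; case: (_ \in _); rewrite /= ?addr0 ?add0r.
Qed.

Lemma measurable_visits A n : measurable A -> measurable_fun setT (visits A n).
Proof.
move=> mA; apply: measurable_sum => i.
exact: (measurableT_comp (measurable_indic mA) (measurable_coord i)).
Qed.

Lemma measurable_visits_gt A n (r : R) : measurable A ->
  measurable [set w | r < visits A n w].
Proof.
move=> mA; rewrite -[X in measurable X]setTI.
rewrite (_ : [set w | _] = visits A n @^-1` `]r, +oo[); last first.
  by apply/seteqP; split=> w /=; rewrite in_itv/= andbT.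
by apply: measurable_visits.
Qed.

Lemma measurable_excess A c : measurable A -> measurable (excess A c).
Proof.
move=> mA; rewrite (_ : excess A c = \bigcap_k \bigcup_n
    [set w | c * n%:R + k%:R < visits A n w]).
  apply: bigcapT_measurable => k; apply: bigcupT_measurable => n.
  exact: measurable_visits_gt.
apply/seteqP; split=> [w Aw k _|w Aw k]; first by have [n ?] := Aw k; exists n.
by have [n _ ?] := Aw k I; exists n.
Qed.

(** Removing the first step changes [visits A n w - c * n] by the bounded amount [1_A (w 0) - c],
    which is absorbed by a larger [k]. *)
Lemma excess_shift A c : 0 <= c -> @path_shift _ T @^-1` excess A c = excess A c.
Proof.
move=> c0.
have i01 (x : T) : 0 <= (\1_A x : R) <= 1 by rewrite indicE ler0n lern1 leq_b1.
apply/seteqP; split=> [w Aw k|w Aw k].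
  have [n hn] := Aw (k + Num.bound c)%N; exists n.+1.
  have cb : c < (Num.bound c)%:R by apply: archi_boundP.
  have /andP[? ?] := i01 (w 0%N).
  by rewrite visitsS; move: hn; rewrite natrD -natr1 mulrDr mulr1; lra.
have [[|n]] := Aw k.+1.
  by rewrite /visits big_ord0 mulr0 add0r ltNge ler0n.
rewrite visitsS -!natr1 mulrDr mulr1 => hn; exists n.
by have /andP[? ?] := i01 (w 0%N); lra.
Qed.

(* [max_excess A c N w] is the maximum of [visits A n w - c * n] over [n <= N] *)
Fixpoint max_excess A c (N : nat) w : R :=
  if N is N'.+1 then
    Num.max 0 (\1_A (w 0%N) - c + max_excess A c N' (path_shift w))
  else 0.

Lemma max_excess_ge0 A c N w : 0 <= max_excess A c N w.
Proof. by case: N => //= N; rewrite le_max lexx. Qed.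

Lemma max_excessS A c N w : max_excess A c N w <= max_excess A c N.+1 w.
Proof.
elim: N w => [w|N IH w]; first by rewrite max_excess_ge0.
have := IH (path_shift w) => /= h.
by rewrite ge_max le_max lexx /= le_max lerD2l h orbT.
Qed.

Lemma visits_max_excess A c N w : visits A N w - c * N%:R <= max_excess A c N w.
Proof.
elim: N w => [w|N IH w]; first by rewrite /visits big_ord0 mulr0 subr0.
by rewrite /= le_max visitsS -natr1; apply/orP; right; have := IH (path_shift w); lra.
Qed.

Lemma max_excess_le A c N w : 0 <= c -> max_excess A c N w <= N%:R.
Proof.
move=> c0; elim: N w => //= N IH w.
rewrite ge_max ler0n /= -natr1; have := IH (path_shift w).
have : \1_A (w 0%N) <= 1 :> R by rewrite indicE ?ler0n ?lern1 ?leq_b1.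
by lra.
Qed.

Lemma measurable_max_excess A c N : measurable A ->
  measurable_fun setT (max_excess A c N).
Proof.
move=> mA; elim: N => [|N IH]; first exact: measurable_cst.
apply: measurable_maxr; first exact: measurable_cst.
apply: measurable_funD; last exact: (measurableT_comp IH (@measurable_path_shift _ T)).
apply: measurable_funB; last exact: measurable_cst.
exact: (measurableT_comp (measurable_indic mA) (measurable_coord 0)).
Qed.

(** Pointwise form of Garsia's argument for the maximal ergodic theorem. Where the maximum is
    positive it equals [1_A (w 0) - c] plus the maximum of the shifted path over one step less,
    which [max_excessS] bounds; elsewhere the left side is 0. Under a shift-invariant law the two
    maxima have the same integral. *)
Lemma max_excess_drift A c N w : 0 <= c ->
  c * \1_[set w | 0 < max_excess A c N w] w + max_excess A c N w <=
  \1_A (w 0%N) + max_excess A c N (path_shift w).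
Proof.
move=> c0; rewrite indicE; have [|/negP] := boolP (_ \in _).
  rewrite inE /= mulr1; case: N => [|N]; first by rewrite /= ltxx.
  have := max_excessS A c N (path_shift w).
  move: (max_excess A c N.+1 (path_shift w)) => m /=.
  set x := (_ + max_excess _ _ _ _).
  by rewrite lt_max ltxx /= => mN /ltW x0; rewrite max_r// /x; lra.
rewrite inE /= => /negP; rewrite -leNgt => h.
have := max_excess_ge0 A c N w; have := max_excess_ge0 A c N (path_shift w).
have : 0 <= \1_A (w 0%N) :> R by rewrite indicE ?ler0n ?lern1 ?leq_b1.
by rewrite mulr0; lra.
Qed.

End visits.

Lemma nonincreasing_null_small (d : measure_display) (T : measurableType d)
    (R : realType) (nu : {measure set T -> \bar R}) (F : (set T)^nat) (eps : R) :
  nu setT < +oo -> (forall n, measurable (F n)) -> nonincreasing_seq F ->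
  nu (\bigcap_n F n) = 0 -> (0 < eps)%R -> exists n, nu (F n) <= eps%:E.
Proof.
move=> nu_fin mF niF F0 eps0.
have fin n : nu (F n) < +oo.
  by rewrite (le_lt_trans _ nu_fin)// le_measure ?inE.
have : nu (F n) @[n --> \oo] --> 0%:E.
  by rewrite -[X in _ --> X]F0; apply: nonincreasing_cvg_mu => //; exact: bigcapT_measurable.
move=> /fine_cvgP[_ /cvgrPdist_le/(_ _ eps0)[n _ /(_ n (leqnn n))]] /=.
rewrite sub0r normrN ger0_norm ?fine_ge0// => h; exists n.
by rewrite -[nu _]fineK ?lee_fin// ge0_fin_numE.
Qed.

Section ergodic_bound.
Context (d : measure_display) (T : measurableType d) (R : realType).
Variable P : R.-pker T ~> T.

(** Integrating [max_excess_drift], the integrals of [max_excess] along [w] and along its shift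
    agree by stationarity; they cancel because [max_excess] is at most [N], so their common value is
    finite. *)
Lemma maximal_inequality mu (Q : probability (path_space T) R) (A : set T) (c : R) N :
  invariant_measure P mu -> chain_law P mu Q -> measurable A -> (0 <= c)%R ->
  c%:E * Q [set w | (0 < max_excess A c N w)%R] <= mu A.
Proof.
move=> inv PQ mA c0; set D := [set w | _].
have mM := measurable_max_excess c N mA.
have mD : measurable D.
  rewrite -[D]setTI (_ : D = max_excess A c N @^-1` `]0%R, +oo[); first exact: mM.
  by apply/seteqP; split=> w /=; rewrite in_itv/= andbT.
have mA0 := measurable_coord_preimage 0 mA.
have M0 w : 0 <= (max_excess A c N w)%:E by rewrite lee_fin max_excess_ge0.
have mME : measurable_fun setT (fun w => (max_excess A c N w)%:E).
  exact/measurable_EFinP.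
have shiftM : \int[Q]_w (max_excess A c N (path_shift w))%:E =
    \int[Q]_w (max_excess A c N w)%:E.
  pose sh := mfun_of (@measurable_path_shift _ T).
  transitivity (\int[pushforward Q sh]_w (max_excess A c N w)%:E).
    by rewrite (ge0_integral_pushforward (@measurable_path_shift _ T)).
  by apply: eq_measure_integral => B mB _; exact: (chain_law_stationary inv PQ).
have finM : \int[Q]_w (max_excess A c N w)%:E \is a fin_num.
  rewrite ge0_fin_numE; last exact: integral_ge0.
  apply: (@le_lt_trans _ _ (\int[Q]_w (cst N%:R%:E) w)).
    by apply: ge0_le_integral => // w _; rewrite lee_fin max_excess_le.
  by rewrite integral_cst//= probability_setT mule1 ltry.
rewrite -(leeD2rE _ _ finM) -{2}shiftM.
have QA : mu A = \int[Q]_w (\1_A (w 0%N))%:E.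
  have [<- // _] := PQ.
  rewrite (_ : (fun w : path_space T => _) =
    (fun w => (\1_[set w : path_space T | A (w 0%N)] w)%:E))//.
  by rewrite integral_indic// setIT.
have m1 : measurable_fun setT (fun w : path_space T => (\1_A (w 0%N) : R)%:E).
  apply/measurable_EFinP.
  exact: (measurableT_comp (measurable_indic mA) (measurable_coord 0)).
rewrite QA -ge0_integralD//;
  last exact: (measurableT_comp mME (@measurable_path_shift _ T)).
rewrite -[D in Q D]setIT -integral_indic// -ge0_integralZl//; last first.
  exact/measurable_EFinP/measurable_indic.
rewrite -ge0_integralD//; last 2 first.
- by move=> w _; rewrite mule_ge0// lee_fin.
- by apply: measurable_funeM; exact/measurable_EFinP/measurable_indic.
apply: ge0_le_integral => //.
- by move=> w _; rewrite adde_ge0// mule_ge0// lee_fin.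
- apply: emeasurable_funD => //.
  by apply: measurable_funeM; exact/measurable_EFinP/measurable_indic.
- apply: emeasurable_funD => //.
  exact: (measurableT_comp mME (@measurable_path_shift _ T)).
- by move=> w _; rewrite -EFinM -!EFinD lee_fin; exact: max_excess_drift.
Qed.

(** By ergodicity the invariant event has probability 0 or 1. It is contained in the increasing
    union of the events [max_excess > 0], whose probabilities are at most [mu A / c < 1], so the
    value 1 is excluded. *)
Lemma excess_null mu (Q : probability (path_space T) R) (A : set T) (c : R) :
  invariant_measure P mu -> chain_law P mu Q -> shift_ergodic Q ->
  measurable A -> mu A < c%:E -> Q (excess A c) = 0.
Proof.
move=> inv PQ erg mA muAc.
have c0 : (0 < c)%R by rewrite -lte_fin (le_lt_trans _ muAc).
have mE := measurable_excess c mA.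
have [//|Q1] := erg _ mE (excess_shift A (ltW c0)).
pose D N := [set w | (0 < max_excess A c N w)%R].
have mD N : measurable (D N).
  rewrite -[D N]setTI (_ : D N = max_excess A c N @^-1` `]0%R, +oo[).
    exact: measurable_max_excess.
  by apply/seteqP; split=> w /=; rewrite in_itv/= andbT.
have ED : excess A c `<=` \bigcup_N D N.
  move=> w /(_ 0%N)[n]; rewrite addr0 => hn; exists n => //.
  by apply: lt_le_trans (visits_max_excess A c n w); rewrite subr_gt0.
have mUD : measurable (\bigcup_N D N) by exact: bigcupT_measurable.
have DS : nondecreasing_seq D.
  apply/nondecreasing_seqP => n; apply/subsetPset => w h.
  exact: lt_le_trans h (max_excessS A c n w).
have cvgD := nondecreasing_cvg_mu mD mUD DS (mu := Q).
have fmu : mu A \is a fin_num by exact: fin_num_measure.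
have QD N : Q (D N) <= (fine (mu A) / c)%:E.
  rewrite EFinM muleC lee_pdivlMl// fineK//.
  exact: (maximal_inequality N inv PQ mA (ltW c0)).
have : Q (\bigcup_N D N) <= (fine (mu A) / c)%:E.
  rewrite -(cvg_lim _ cvgD)//; apply: lime_le; first by apply/cvg_ex; eexists; exact: cvgD.
  by apply: nearW => n; exact: QD.
have : Q (excess A c) <= Q (\bigcup_N D N) by apply: le_measure; rewrite ?inE.
move=> /le_trans h /h; rewrite Q1 lee_fin ler_pdivlMr// mul1r -lee_fin fineK//.
by rewrite leNgt muAc.
Qed.

End ergodic_bound.

(** * Expected visit frequencies of random paths *)

Section average_visits.
Context (dS d : measure_display) (S : measurableType dS) (T : measurableType d).
Context (R : realType).

(** Here [Q] is any law and [X] any random path, so that either component of a generalized coupling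
    qualifies. The events [B k] decrease to a null event, hence some [B k] has probability at most
    [c]. On it there are at most [n] visits, which contributes [c * n]; off it at most [c * n + k],
    that is, at most [2 * c * n] once [n] is at least [k / c]. *)
Lemma average_visits_le (Q : probability S R) (X : S -> path_space T)
    (A : set T) (c : R) :
  measurable_fun setT X -> measurable A -> (0 < c)%R ->
  Q (X @^-1` excess A c) = 0 ->
  \forall n \near \oo, \sum_(0 <= i < n) Q [set w | A (X w i)] <= (3 * c * n%:R)%:E.
Proof.
move=> mX mA c0 QX0.
pose B k := [set w | exists n, (c * n%:R + k%:R < visits R A n (X w))%R].
have BE k : B k = X @^-1` \bigcup_n [set w : path_space T | (c * n%:R + k%:R < visits R A n w)%R].
  by apply/seteqP; split=> [w [n ?]|w [n _ ?]]; exists n.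
have mB k : measurable (B k).
  rewrite BE -[X in measurable X]setTI; apply: mX => //.
  by apply: bigcupT_measurable => n; exact: measurable_visits_gt.
have capB : \bigcap_k B k = X @^-1` excess A c.
  by apply/seteqP; split=> [w Bw k|w Bw k _]; [exact: Bw|exact: Bw].
have BS : nonincreasing_seq B.
  apply/nonincreasing_seqP => k; apply/subsetPset => w [n hn]; exists n.
  by rewrite (le_lt_trans _ hn)// lerD2l ler_nat.
have [k Bk] : exists k, Q (B k) <= c%:E.
  apply: nonincreasing_null_small => //; last by rewrite capB.
  by rewrite (le_lt_trans (probability_le1 _ _))// ltry.
have mAi i : measurable [set w | A (X w i)].
  rewrite -[X in measurable X]setTI.
  exact: (measurableT_comp (measurable_coord i) mX).
near=> n.
have kn : (k%:R <= c * n%:R)%R.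
  rewrite mulrC -ler_pdivrMr//; near: n; exact: nbhs_infty_ger.
have sumE : \sum_(0 <= i < n) Q [set w | A (X w i)] = \int[Q]_w (visits R A n (X w))%:E.
  under [RHS]eq_integral do rewrite /visits -sumEFin.
  rewrite ge0_integral_sum//.
  - rewrite big_mkord; apply: eq_bigr => i _.
    rewrite (_ : (fun w : S => _) = (fun w => (\1_[set w | A (X w i)] w)%:E))//.
    by rewrite integral_indic// setIT.
  - move=> i; apply/measurable_EFinP.
    apply: (measurableT_comp (measurable_indic mA)).
    exact: (measurableT_comp (measurable_coord i) mX).
rewrite sumE.
apply: (@le_trans _ _ (\int[Q]_w (n%:R%:E * (\1_(B k) w)%:E + (cst (2 * c * n%:R)%:E) w))).
  apply: ge0_le_integral => //.
  - by move=> w _; rewrite lee_fin visits_ge0.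
  - apply/measurable_EFinP; exact: (measurableT_comp (@measurable_visits _ _ R A n mA) mX).
  - apply: emeasurable_funD => //; apply: measurable_funeM.
    exact/measurable_EFinP/measurable_indic.
  - move=> w _; rewrite -EFinM -EFinD lee_fin indicE.
    have [_|/negP] := boolP (w \in B k).
      rewrite mulr1 ler_wpDr//; first by rewrite mulr_ge0// mulr_ge0// ltW.
      apply: (@le_trans _ _ (\sum_(i < n) 1)%R); last by rewrite sumr_const card_ord.
      apply: ler_sum => i _.
      by rewrite indicE lern1 leq_b1.
    rewrite inE => nBw; rewrite mulr0 add0r leNgt; apply/negP => h; apply: nBw.
    by exists n; rewrite (le_lt_trans _ h)// -mulrA mulr2n mulrDl mul1r lerD2l.
rewrite ge0_integralD//; last 2 first.
- by apply: measurable_funeM; exact/measurable_EFinP/measurable_indic.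
- by move=> w _; rewrite lee_fin mulr_ge0// mulr_ge0// ltW.
rewrite ge0_integralZl//; last exact/measurable_EFinP/measurable_indic.
rewrite integral_indic// setIT integral_cst//= probability_setT mule1.
have -> : (3 * c * n%:R)%:E = n%:R%:E * c%:E + (2 * c * n%:R)%:E.
  by rewrite -EFinM -EFinD; congr (_%:E); ring.
by rewrite leeD2rE// lee_wpmul2l// lee_fin.
Unshelve. all: by end_near. Qed.

End average_visits.

(** * Sets at positive distance *)

Section separated_approximation.
Context (disp : measure_display) (T : measurableType disp) (R : realType).
Variables (d : T -> T -> R) (nu : {measure set T -> \bar R}).
Hypotheses (d_sym : forall x y, d x y = d y x) (nu_fin : nu setT < +oo).

(** Approximating [A] and its complement together makes the property symmetric, hence stable under
    complements, as needed for a sigma-algebra argument. *)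
Definition separated_approximable (A : set T) : Prop :=
  forall eps : R, (0 < eps)%R -> exists A1 A2 : set T,
    [/\ measurable A1 /\ measurable A2, A1 `<=` A /\ A2 `<=` ~` A,
        exists2 delta : R, (0 < delta)%R &
          forall x y, A1 x -> A2 y -> (delta <= d x y)%R &
        nu (~` (A1 `|` A2)) <= eps%:E].

Let nu_le (A B : set T) : measurable A -> measurable B -> A `<=` B -> nu A <= nu B.
Proof. by move=> mA mB AB; apply: le_measure; rewrite ?inE. Qed.

Let nu_leU (A B C : set T) (r s : R) : measurable A -> measurable B -> measurable C ->
  A `<=` B `|` C -> nu B <= r%:E -> nu C <= s%:E -> nu A <= (r + s)%:E.
Proof.
move=> mA mB mC ABC nuB nuC; rewrite EFinD.
apply: (@le_trans _ _ (nu (B `|` C))); first by apply: nu_le => //; exact: measurableU.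
by rewrite (le_trans (measureU2 _ _ _))// leeD.
Qed.

Lemma nondecreasing_bigcup_rest (F : (set T)^nat) (eps : R) :
  (forall n, measurable (F n)) -> nondecreasing_seq F -> (0 < eps)%R ->
  exists N, nu (\bigcup_n F n `\` F N) <= eps%:E.
Proof.
move=> mF ndF eps0.
have mU : measurable (\bigcup_n F n) by exact: bigcupT_measurable.
pose G N := \bigcup_n F n `\` F N.
have mG N : measurable (G N) by exact: measurableD.
have G0 : \bigcap_N G N = set0.
  rewrite -subset0 => x Gx; have [[n _ Fx] _] := Gx 0%N I.
  by have [_] := Gx n I.
apply: (@nonincreasing_null_small _ _ _ nu G) => //.
- by move=> m n mn; apply/subsetPset; apply: setDS; exact/subsetPset/ndF.
- by rewrite G0 measure0.
Qed.

Lemma separated_approximableC A :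
  separated_approximable A -> separated_approximable (~` A).
Proof.
move=> sA eps /sA[A1 [A2 [[m1 m2] [s1 s2] [delta delta0 dA] nuA]]].
exists A2, A1; split=> //; first by rewrite setCK.
- by exists delta => // x y ? ?; rewrite d_sym dA.
- by rewrite setUC.
Qed.

Lemma separated_approximableU A B :
  separated_approximable A -> separated_approximable B ->
  separated_approximable (A `|` B).
Proof.
move=> sA sB eps eps0; have eps2 : (0 < eps / 2)%R by rewrite divr_gt0.
have [A1 [A2 [[mA1 mA2] [sA1 sA2] [a a0 da] nuA]]] := sA _ eps2.
have [B1 [B2 [[mB1 mB2] [sB1 sB2] [b b0 db] nuB]]] := sB _ eps2.
exists (A1 `|` B1), (A2 `&` B2); split.
- by split; [exact: measurableU|exact: measurableI].
- by split; [exact: setUSS|rewrite setCU; exact: setISS].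
- exists (Num.min a b); first by rewrite lt_min a0.
  move=> x y [Ax|Bx] [Ay By]; rewrite ge_min; first by rewrite da.
  by rewrite db ?orbT.
- rewrite [eps]splitr; apply: nu_leU nuA nuB.
  + by apply: measurableC; apply: measurableU; [exact: measurableU|exact: measurableI].
  + by apply: measurableC; exact: measurableU.
  + by apply: measurableC; exact: measurableU.
  + move=> x; rewrite /= => nx.
    have [A2x|nA2x] := pselect (A2 x); [right|left]; move=> [?|?]; apply: nx => //.
    * by left; right.
    * by right.
    * by left; left.
Qed.

Lemma separated_approximable_bigcup (F : (set T)^nat) :
  (forall n, measurable (F n)) -> (forall n, separated_approximable (F n)) ->
  separated_approximable (\bigcup_n F n).
Proof.
move=> mF sF.
pose G n := \big[setU/set0]_(i < n.+1) F i.
have mG n : measurable (G n) by exact: bigsetU_measurable.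
have sG n : separated_approximable (G n).
  elim: n => [|n IH]; first by rewrite /G big_ord1.
  by rewrite /G big_ord_recr; exact: separated_approximableU.
have ndG : nondecreasing_seq G.
  by apply/nondecreasing_seqP => n; apply/subsetPset; rewrite /G [X in _ `<=` X]big_ord_recr; exact: subsetUl.
rewrite -(bigcup_bigsetU_bigcup F) -/G.
have mU : measurable (\bigcup_n G n) by exact: bigcupT_measurable.
move=> eps eps0; have eps2 : (0 < eps / 2)%R by rewrite divr_gt0.
have [N nuN] := nondecreasing_bigcup_rest mG ndG eps2.
have [A1 [A2 [[m1 m2] [s1 s2] [a a0 da] nuA]]] := sG N _ eps2.
(* [A2] avoids only the finite union [G N]. Removing the whole union from it loses points of the
   tail alone, whose mass is at most [eps / 2]. *)
exists A1, (A2 `&` ~` \bigcup_n G n); split.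
- by split=> //; apply: measurableI => //; exact: measurableC.
- by split; [move=> x /s1 ?; exists N|exact: subIsetr].
- by exists a => // x y ? [? _]; exact: da.
- rewrite [eps]splitr; apply: nu_leU nuA nuN.
  + apply: measurableC; apply: measurableU => //; apply: measurableI => //.
    exact: measurableC.
  + by apply: measurableC; exact: measurableU.
  + exact: measurableD.
  + move=> x nx; have [A12x|] := pselect ((A1 `|` A2) x); last by left.
    right; case: A12x => [A1x|A2x]; first by exfalso; apply: nx; left.
    split; last exact: s2.
    by apply: contrapT => nUx; apply: nx; right.
Qed.

End separated_approximation.

(** * The metric [d] and the Borel sets of [rho] *)

Section metric_borel.
Context (R : realType) (E : completeMetricType R).
Hypothesis separableE : separable_space E.

Lemma dense_sequence : exists u : nat -> E,
  forall x (e : R), (0 < e)%R -> exists n, (mdist (u n) x < e)%R.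
Proof.
have [D /countable_injP[f finj] denseD] := separableE.
(* [f] codes [D] injectively; an index that codes no element of [D] is sent to the default
   [point]. *)
exists (fun n => xget point [set x | D x /\ f x = n]) => x e e0.
have [||y [ey Dy]] := denseD (interior (ball x e)).
- by exists x; exact: nbhsx_ballx.
- exact: open_interior.
- exists (f y); case: xgetP => [z _ [Dz fzy]|/(_ y)[]//].
  have -> : z = y by apply: finj; rewrite ?inE.
  by have := interior_subset ey; rewrite ballEmdist/= metric_sym.
Qed.

Variable d : E -> E -> R.
Hypotheses (d_metric : is_metric d) (d_continuous : continuous (fun z : E * E => d z.1 z.2)).

Let d_sym x y : d x y = d y x. Proof. by case: d_metric. Qed.

Let d_continuousl a : continuous (fun x => d x a).
Proof.
move=> x; apply: (@cvg_comp _ _ _ (fun x => (x, a)) (fun z : E * E => d z.1 z.2)).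
  exact: (cvg_pair (@cvg_id _ _) (@cvg_cst _ _ _ _ _)).
exact: (@d_continuous (x, a)).
Qed.

Lemma open_dist_lt a r : open [set x | (d x a < r)%R].
Proof.
have := @open_lt _ r; apply: open_comp => x _; exact: d_continuousl.
Qed.

Lemma open_dist_gt a r : open [set x | (r < d x a)%R].
Proof.
have := @open_gt _ r; apply: open_comp => x _; exact: d_continuousl.
Qed.

(** Measurability is for the product of the Borel sigma-algebras, so the complement is written as a
    countable union of open rectangles. Their centres [u n] are dense for [rho], and come close in
    [d] as well by continuity of [d]. *)
Lemma measurable_dist_le (r : R) :
  measurable [set z : borel E * borel E | (d z.1 z.2 <= r)%R].
Proof.
have [dxx _ _ dtri] := d_metric.
have [u du] := dense_sequence.
rewrite (_ : [set z | _] = ~` \bigcup_n \bigcup_k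
    ([set x : borel E | (d x (u n) < k.+1%:R^-1)%R] `*`
     [set y : borel E | (r + k.+1%:R^-1 < d y (u n))%R])); last first.
  apply/seteqP; split=> [[x y] /= dr [n _ [k _ [/= xu yu]]]|[x y] /= nxy].
    move: (k.+1%:R^-1)%R xu yu => e xu yu.
    by have := dtri y x (u n); rewrite (d_sym y x); move: dr xu yu; move: (d x y) (d x (u n)) (d y (u n)) => a b c; lra.
  rewrite leNgt; apply/negP => rd; apply: nxy.
  (* Half of the gap: the radius 1 / (k + 1) is spent twice, in the distance from [x] to [u n] and
     in the margin above [r]. *)
  have e0 : (0 < (d x y - r) / 2)%R by rewrite divr_gt0// subr_gt0.
  have /= := near_infty_natSinv_lt (PosNum e0); move=> [k _ /(_ k (leqnn k)) /= hk].
  have nk : nbhs x [set z | (d z x < k.+1%:R^-1)%R].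
    by apply: open_nbhs_nbhs; split; [exact: open_dist_lt|rewrite /= dxx].
  have [e /= e1 eball] : exists2 e : R, (0 < e)%R & ball x e `<=` [set z | (d z x < k.+1%:R^-1)%R].
    by have /nbhs_ballP[e /= ? ?] := nk; exists e.
  have [n un] := du x e e1; exists n => //; exists k => //; split=> /=.
    by rewrite d_sym; apply: eball; rewrite ballEmdist /= metric_sym.
  have : (d (u n) x < k.+1%:R^-1)%R by apply: eball; rewrite ballEmdist /= metric_sym.
  have := dtri x (u n) y; rewrite (d_sym x (u n)) (d_sym y (u n)).
  move: hk; move: (k.+1%:R^-1)%R (d x y) (d (u n) x) (d (u n) y) => e2 a b c; lra.
apply: measurableC; apply: bigcupT_measurable => n; apply: bigcupT_measurable => k.
by apply: measurableX; apply: sub_sigma_algebra; [exact: open_dist_lt|exact: open_dist_gt].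
Qed.

Variables (Ebar : completeMetricType R) (iota : E -> Ebar).
Hypotheses (Ebar_completion : is_completion d iota) (rho_approx : approximable_metric iota).

(** The open sets of [d] are given explicitly, since [E] already carries the topology of [rho]. *)
Definition dist_open : set (set E) :=
  [set U | forall x, U x -> exists2 e : R, (0 < e)%R & forall y, (d x y < e)%R -> U y].

Lemma dist_open_open U : dist_open U -> open U.
Proof.
have [dxx _ _ _] := d_metric.
move=> dU; rewrite openE => x /dU[e e0 eU].
have : nbhs x [set y | (d y x < e)%R].
  by apply: open_nbhs_nbhs; split; [exact: open_dist_lt|rewrite /= dxx].
by apply: filterS => y /=; rewrite d_sym; exact: eU.
Qed.

(* The topology of [d] may be coarser than that of [rho], but [rho] is a pointwise
   limit of [d]-continuous functions. *)
Lemma borel_dist_open (A : set E) : @measurable _ (borel E) A -> <<s dist_open >> A.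
Proof.
have [iota_isom _] := Ebar_completion.
pose D := g_sigma_algebraType dist_open.
have mf (f : Ebar -> R) : continuous f -> measurable_fun setT (f \o iota : D -> R).
  move=> cf; apply: (measurability (@RGenOInfty.G R)); first exact: RGenOInfty.measurableE.
  move=> _ [_ [r ->] <-]; rewrite setTI; apply: sub_sigma_algebra => x /=.
  rewrite in_itv/= andbT => rfx.
  have : nbhs (iota x) [set z | (r < f z)%R].
    apply: open_nbhs_nbhs; split=> //.
    have := @open_gt _ r; apply: open_comp => z _; exact: cf.
  move=> /nbhs_ballP[e /= e0 ball_e]; exists e => // y dxy.
  by rewrite in_itv/= andbT; apply: ball_e; rewrite ballEmdist/= iota_isom.
have mball (y : E) (r : R) : <<s dist_open >> [set x | (mdist x y < r)%R].
  have [f [cf _ ftorho _]] := rho_approx y.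
  have mrho : measurable_fun setT ((fun x => mdist x y) : D -> R).
    apply: (@measurable_fun_cvg _ D R setT (fun n => f n \o iota) (fun x => mdist x y)) => [m|x _].
      exact: mf.
    exact: ftorho.
  have := mrho measurableT [set` `]-oo, r[%R] (measurable_itv _).
  by rewrite setTI; congr (<<s _ >> _); apply/seteqP; split=> x /=; rewrite in_itv.
move: A; apply: smallest_sub; first exact: smallest_sigma_algebra.
move=> U /= oU; have [u du] := dense_sequence.
(* By separability [U] is the countable union of the balls with centre [u n] and radius 1 / (k + 1)
   that it contains. A radius below [e / 2] keeps such a ball, if it contains [x], within [e] of
   [x]. *)
pose J n k := [set x | (mdist x (u n) < k.+1%:R^-1)%R] `<=` U.
rewrite (_ : U = \bigcup_n \bigcup_k
    (if `[< J n k >] then [set x | (mdist x (u n) < k.+1%:R^-1)%R] else set0)).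
  apply: (@bigcupT_measurable _ D) => n; apply: (@bigcupT_measurable _ D) => k.
  by case: ifP => _; [exact: mball|exact: (@measurable0 _ D)].
apply/seteqP; split=> [x Ux|x [n _ [k _]]]; last by case: asboolP => // h; exact: h.
have /nbhs_ballP[e /= e0 eU] : nbhs x U by exact: open_nbhs_nbhs.
have e2 : (0 < e / 2)%R by rewrite divr_gt0.
have /= := near_infty_natSinv_lt (PosNum e2); move=> [k _ /(_ k (leqnn k)) /= hk].
have [n un] := du x k.+1%:R^-1%R ltac:(by rewrite invr_gt0); exists n => //; exists k => //.
case: asboolP => [_|]; first by rewrite /= metric_sym.
case=> y /= yu; apply: eU; rewrite ballEmdist /=.
rewrite (le_lt_trans (metric_triangle _ (u n) _))// metric_sym (metric_sym _ y).
by move: hk un yu; move: (k.+1%:R^-1)%R (mdist (u n) x) (mdist y (u n)) => e' a b; lra.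
Qed.

(** The measurable sets with this property form a sigma-algebra, so by [borel_dist_open] only
    [d]-open sets remain. Such a [U] is exhausted by the points at [d]-distance at least 1 / (k + 1)
    from its complement, and the complement serves as second set. *)
Lemma measurable_separated (nu : {measure set (borel E) -> \bar R}) (A : set (borel E)) :
  nu setT < +oo -> measurable A -> @separated_approximable _ (borel E) R d nu A.
Proof.
move=> nu_fin /borel_dist_open.
suff : <<s dist_open >> `<=` [set A : set (borel E) | measurable A /\ @separated_approximable _ (borel E) R d nu A].
  by move=> h /h[].
apply: smallest_sub.
  split=> [|B [mB sB]|F FP].
  - split=> // eps eps0; exists set0, setT; split.
    + by split; [exact: measurable0|exact: measurableT].
    + by split=> //; rewrite setC0.
    + by exists 1%R.
    + by rewrite setUT setCT measure0 lee_fin ltW.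
  - by rewrite setTD; split; [exact: measurableC|exact: separated_approximableC].
  - split; first by apply: bigcupT_measurable => n; case: (FP n).
    by apply: separated_approximable_bigcup => // n; case: (FP n).
move=> U dU; have mU : @measurable _ (borel E) U.
  by apply: sub_sigma_algebra; exact: dist_open_open.
split=> // eps eps0.
pose B k := [set x : borel E | forall z, ~ U z -> (k.+1%:R^-1 <= d x z)%R].
have mB k : measurable (B k).
  rewrite -[B k]setCK; apply: measurableC; apply: sub_sigma_algebra.
  rewrite (_ : ~` B k = \bigcup_(z in ~` U) [set x | (d x z < k.+1%:R^-1)%R]).
    by apply: bigcup_open => z _; exact: open_dist_lt.
  apply/seteqP; split=> [x /= /existsNP[z /not_implyP[Uz /negP]]|x [z Uz /= xz] /(_ _ Uz)].
    by rewrite -ltNge => ?; exists z.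
  by rewrite leNgt xz.
have ndB : nondecreasing_seq B.
  apply/nondecreasing_seqP => k; apply/subsetPset => x Bx z /Bx.
  by apply: le_trans; rewrite lef_pV2 ?posrE// ler_nat.
have UB : \bigcup_k B k = U.
  apply/seteqP; split=> [x [k _ Bx]|x Ux].
    apply: contrapT => /Bx; have [-> _ _ _] := d_metric.
    by rewrite leNgt invr_gt0 ltr0n.
  have [e e0 eU] := dU x Ux.
  have /= := near_infty_natSinv_lt (PosNum e0); move=> [k _ /(_ k (leqnn k)) /= hk].
  exists k => // z Uz; rewrite leNgt; apply/negP => dxz; apply: Uz; apply: eU.
  exact: lt_trans hk.
have [N nuN] := nondecreasing_bigcup_rest nu_fin mB ndB eps0.
exists (B N), (~` U); split.
- by split=> //; exact: measurableC.
- by split=> // x Bx; rewrite -UB; exists N.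
- by exists N.+1%:R^-1%R => // x y Bx /Bx.
- by rewrite setCU setCK setIC -setDE -{1}UB.
Qed.

End metric_borel.

(** * Ergodic measures *)

Section ergodic_measures.
Context (disp : measure_display) (T : measurableType disp) (R : realType).
Variable P : R.-pker T ~> T.

Lemma chain_law_null_seq mu (Q : probability (path_space T) R)
    (G : (set (path_space T))^nat) :
  chain_law P mu Q -> (forall k, measurable (G k)) -> (forall k, Q (G k) = 0) ->
  exists N, [/\ measurable N, mu N = 0 & forall x Px, chain_law P \d_x Px ->
    ~ N x -> forall k, Px (G k) = 0].
Proof.
move=> PQ mG QG.
have /choice[N NP] := fun k => chain_law_null PQ (mG k) (QG k).
have mN k : measurable (N k) by case: (NP k).
have mU : measurable (\bigcup_k N k) by exact: bigcupT_measurable.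
exists (\bigcup_k N k); split => //.
- apply: measure_negligible => //; apply: negligible_bigcup => k.
  by apply/negligibleP => //; case: (NP k).
- move=> x Px PPx Nx k; have [_ _ h] := NP k; apply: h PPx _ => Nkx.
  by apply: Nx; exists k.
Qed.

(** The frequency of visits to [A] separates the two path laws: the event [excess A c], with [c]
    between [mu1 A] and [mu2 A], is null for [Q1] and has full measure for [Q2]. Its fiber density
    carries the singularity down to the state space. *)
Lemma ergodic_singular_lt mu1 mu2 (A : set T) :
  invariant_measure P mu1 -> ergodic_measure P mu1 ->
  invariant_measure P mu2 -> ergodic_measure P mu2 ->
  measurable A -> mu1 A < mu2 A ->
  exists D, [/\ measurable D, mu1 (~` D) = 0 & mu2 D = 0].
Proof.
move=> inv1 [Q1 PQ1 erg1] inv2 [Q2 PQ2 erg2] mA.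
have f1 : mu1 A \is a fin_num by exact: fin_num_measure.
have f2 : mu2 A \is a fin_num by exact: fin_num_measure.
rewrite -(fineK f1) -(fineK f2) lte_fin.
move Ea : (fine (mu1 A)) => a; move Eb : (fine (mu2 A)) => b ab.
have mu1A : mu1 A = a%:E by rewrite -(fineK f1) Ea.
have mu2A : mu2 A = b%:E by rewrite -(fineK f2) Eb.
(* Any [a < c < c' < b] would do. The gap makes a path outside [excess A c] visit the complement of
   [A] more than [(1 - c') * n] times by an unbounded margin. *)
pose c : R := ((2 * a + b) / 3)%R; pose c' : R := ((a + 2 * b) / 3)%R.
have cc' : (c < c')%R by rewrite /c /c'; lra.
have mG := measurable_excess c mA.
have mAC := measurableC mA.
have mG' := measurable_excess (1 - c')%R mAC.
have QG1 : Q1 (excess A c) = 0.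
  by apply: (excess_null inv1 PQ1 erg1 mA); rewrite mu1A lte_fin /c; lra.
have QG2 : Q2 (excess (~` A) (1 - c')%R) = 0.
  apply: (excess_null inv2 PQ2 erg2 mAC).
  by rewrite probability_setC// mu2A -EFinB lte_fin /c'; lra.
have GG' : ~` excess A c `<=` excess (~` A) (1 - c')%R.
  move=> w /existsNP[k /forallNP wk] k'.
  pose r : R := ((k%:R + k'%:R) / (c' - c))%R.
  have r0 : (0 <= r)%R by rewrite divr_ge0// subr_ge0 ltW.
  have rb := archi_boundP r0.
  exists (Num.bound r); rewrite visitsC; move/negP: (wk (Num.bound r)).
  rewrite -leNgt; move: rb; rewrite /r ltr_pdivrMr ?subr_gt0//.
  move: (visits R A _ w) (Num.bound _)%:R%R => v m; nra.
have QGC : Q2 (~` excess A c) = 0.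
  exact: (subset_measure0 (measurableC mG) mG' GG').
have [h [h0 mh hG]] := fiber_density_exists P mG.
have mD : measurable [set x | h x <= 0].
  by rewrite -[X in measurable X]setTI; exact: emeasurable_fun_infty_c.
(* These are the starting points from which [excess A c] has probability 0. They carry all of [mu1],
   since [Q1] gives the event mass 0; they are [mu2]-null, since [Q2] gives its complement mass
   0. *)
exists [set x | h x <= 0]; split=> //.
- have : \int[mu1]_x `|h x| = 0.
    rewrite (eq_integral h); last by move=> x _; rewrite gee0_abs.
    have := hG _ _ _ PQ1 measurableT.
    by rewrite setIT QG1.
  move=> /(ae_eq_integral_abs mu1 measurableT mh)[M [mM M0 hM]].
  apply: (subset_measure0 (measurableC mD) mM _ M0) => x /= hx.
  by apply: hM => /(_ I) hx0; apply: hx; rewrite hx0.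
- have hD := hG _ _ _ PQ2 mD.
  rewrite integral0_eq in hD; last by move=> x /= hx; apply/eqP; rewrite eq_le hx h0.
  have [<- // _] := PQ2; set D0 : set (path_space T) := [set w | _].
  have mD0 : measurable D0 by exact: measurable_coord_preimage.
  rewrite (measureDI Q2 mD0 mG) (setIC D0).
  rewrite [X in _ + X]hD adde0.
  apply: (subset_measure0 _ (measurableC mG) _ QGC); first exact: measurableD.
  by move=> w [].
Qed.

Lemma ergodic_singular mu1 mu2 (A : set T) :
  invariant_measure P mu1 -> ergodic_measure P mu1 ->
  invariant_measure P mu2 -> ergodic_measure P mu2 ->
  measurable A -> mu1 A <> mu2 A ->
  exists D, [/\ measurable D, mu1 (~` D) = 0 & mu2 D = 0].
Proof.
move=> inv1 erg1 inv2 erg2 mA /eqP; rewrite neq_lt => /orP[lt12|lt21].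
  exact: (ergodic_singular_lt inv1 erg1 inv2 erg2 mA).
have [D [mD D2 D1]] := ergodic_singular_lt inv2 erg2 inv1 erg1 mA lt21.
by exists (~` D); split; rewrite ?setCK//; exact: measurableC.
Qed.

End ergodic_measures.

(** * Choice of a starting pair and the contradiction from its generalized couplings *)

Lemma limn_esup_le_near (R : realType) (u : nat -> \bar R) (l : \bar R) :
  (\forall n \near \oo, u n <= l) -> limn_esup u <= l.
Proof.
move=> ul; apply: (@le_trans _ _ (ereal_sup (u @` [set n | u n <= l]))).
  by apply: ereal_inf_lbound; exists [set n | u n <= l].
by apply: ge_ereal_sup => _ [n un <-].
Qed.

(** Otherwise [M] would be covered by two null strips, over [N1] and over [N2]. *)
Lemma product_measure_conull (d1 d2 : measure_display) (T1 : measurableType d1)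
    (T2 : measurableType d2) (R : realType) (m1 : probability T1 R)
    (m2 : probability T2 R) (N1 : set T1) (N2 : set T2) (M : set (T1 * T2)) :
  measurable N1 -> measurable N2 -> m1 N1 = 0 -> m2 N2 = 0 ->
  measurable M -> 0 < (m1 \x m2) M ->
  exists x y, [/\ M (x, y), ~ N1 x & ~ N2 y].
Proof.
move=> mN1 mN2 N10 N20 mM; apply: contraPP => /forallNP h; apply/negP.
rewrite -leNgt; have MN : M `<=` (N1 `*` setT) `|` (setT `*` N2).
  move=> [x y] Mxy; apply: contrapT => /not_orP[n1 n2].
  by have /forallNP/(_ y) := h x; apply; split=> // ?; [apply: n1|apply: n2].
have mX1 : measurable (N1 `*` [set: T2]) by exact: measurableX.
have mX2 : measurable ([set: T1] `*` N2) by exact: measurableX.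
apply: (@le_trans _ _ ((m1 \x m2) ((N1 `*` setT) `|` (setT `*` N2)))).
  by apply: le_measure; rewrite ?inE//; exact: measurableU.
rewrite (le_trans (measureU2 _ mX1 mX2))//.
rewrite [X in X + _](product_measure1E m1 m2 mN1 measurableT) [X in X * _]N10 mul0e.
by rewrite [X in _ + X](product_measure1E m1 m2 measurableT mN2) [X in _ * X]N20 mule0 adde0.
Qed.

Theorem theorem2p1 (R : realType) (E : completeMetricType R)
  (separableE : separable_space E)
  (rho_le1 : forall x y : E, (mdist x y <= 1 :> R)%R)
  (d : E -> E -> R)
  (d_metric : is_metric d)
  (d_bounded : exists C : R, forall x y, (d x y <= C)%R)
  (d_continuous : continuous (fun z : E * E => d z.1 z.2))
  (Ebar : completeMetricType R) (iota : E -> Ebar)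
  (Ebar_completion : is_completion d iota)
  (rho_approx : approximable_metric iota)
  (P : R.-pker borel E ~> borel E)
  (mu1 mu2 : probability (borel E) R)
  (inv1 : invariant_measure P mu1) (erg1 : ergodic_measure P mu1)
  (inv2 : invariant_measure P mu2) (erg2 : ergodic_measure P mu2)
  (M : set (borel E * borel E))
  (mM : measurable M)
  (M_gt0 : 0 < (mu1 \x mu2) M)
  (HM : forall x y : borel E, M (x, y) ->
    exists Px Py : probability (path_space (borel E)) R,
      [/\ chain_law P \d_x Px, chain_law P \d_y Py &
      exists alpha : R, (0 < alpha)%R /\
        forall eps : R, (0 < eps)%R ->
          exists xi : probability (path_space (borel E) * path_space (borel E))%type R,
            gen_coupling Px Py xi /\
            alpha%:E <= limn_esup (fun n : nat => (n%:R^-1)%:E *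
              \sum_(0 <= i < n) xi [set w | (d (w.1 i) (w.2 i) <= eps)%R])]) :
  forall A : set (borel E), measurable A -> mu1 A = mu2 A.
Proof.
move=> A mA; apply: contrapT => mu12.
have [D [mD muD1 muD2]] := ergodic_singular inv1 erg1 inv2 erg2 mA mu12.
pose nu : {measure set (borel E) -> \bar R} := measure_add mu1 mu2.
have nuE B : nu B = mu1 B + mu2 B by exact: measure_addE.
have nu_fin : nu setT < +oo by rewrite nuE !probability_setT ltry.
pose lam (k : nat) : R := k.+1%:R^-1%R.
have lam0 k : (0 < lam k)%R by rewrite invr_gt0.
have sepD := measurable_separated separableE d_metric d_continuous
  Ebar_completion rho_approx nu_fin mD.
have /choice[K KP] : forall k, exists K : set (borel E) * set (borel E),
    [/\ measurable K.1 /\ measurable K.2, mu1 (~` K.1) < (lam k)%:E,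
        mu2 (~` K.2) < (lam k)%:E &
        exists2 delta : R, (0 < delta)%R &
          forall x y, K.1 x -> K.2 y -> (delta <= d x y)%R].
  (* Half of [lam k], because [excess_null] asks for a strict inequality. *)
  move=> k; have lk2 : (0 < lam k / 2)%R by rewrite divr_gt0.
  have [K1 [K2 [[mK1 mK2] [sK1 sK2] sep nuK]]] := sepD _ lk2.
  have lt_lam : (lam k / 2)%:E < (lam k)%:E.
    by rewrite lte_fin ltr_pdivrMr// ltr_pMr// ltr1n.
  have mrest : measurable (~` (K1 `|` K2)) by apply: measurableC; exact: measurableU.
  have mu_small (mu : probability (borel E) R) (K0 N : set (borel E)) :
      (forall B, mu B <= nu B) -> measurable K0 -> measurable N -> mu N = 0 ->
      ~` K0 `<=` ~` (K1 `|` K2) `|` N -> mu (~` K0) < (lam k)%:E.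
    move=> munu mK0 mN N0 sK0; apply: le_lt_trans lt_lam.
    apply: le_trans nuK; apply: le_trans (munu _).
    rewrite -[leRHS]adde0 -N0; apply: le_trans (measureU2 _ mrest mN).
    by apply: le_measure; rewrite ?inE//; [exact: measurableC|exact: measurableU].
  exists (K1, K2); split=> //.
  - apply: (mu_small mu1 K1 (~` D)) => //; last by move=> x /= nx;
      have [?|?] := pselect (K2 x); [right; exact: sK2|left=> -[]].
    + by move=> B; rewrite nuE leeDl.
    + exact: measurableC.
  - apply: (mu_small mu2 K2 D) => //; last by move=> x /= nx;
      have [?|?] := pselect (K1 x); [right; exact: sK1|left=> -[]].
    by move=> B; rewrite nuE leeDr.
have mK1 k : measurable (~` (K k).1) by apply: measurableC; case: (KP k) => -[].
have mK2 k : measurable (~` (K k).2) by apply: measurableC; case: (KP k) => -[].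
have [Q1 PQ1 ergQ1] := erg1; have [Q2 PQ2 ergQ2] := erg2.
have [N1 [mN1 N10 N1P]] : exists N, [/\ measurable N, mu1 N = 0 &
    forall x Px, chain_law P \d_x Px -> ~ N x ->
    forall k, Px (excess (~` (K k).1) (lam k)) = 0].
  apply: (chain_law_null_seq PQ1) => k; first exact: measurable_excess.
  by apply: (excess_null inv1 PQ1 ergQ1) => //; case: (KP k).
have [N2 [mN2 N20 N2P]] : exists N, [/\ measurable N, mu2 N = 0 &
    forall x Px, chain_law P \d_x Px -> ~ N x ->
    forall k, Px (excess (~` (K k).2) (lam k)) = 0].
  apply: (chain_law_null_seq PQ2) => k; first exact: measurable_excess.
  by apply: (excess_null inv2 PQ2 ergQ2) => //; case: (KP k).
have [x [y [Mxy nx ny]]] := product_measure_conull mN1 mN2 N10 N20 mM M_gt0.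
have [Px [Py [PPx PPy [alpha [alpha0 HMxy]]]]] := HM x y Mxy.
(* Each of the two components contributes a frequency of at most [3 * lam k]. *)
have alpha6 : (0 < alpha / 6)%R by rewrite divr_gt0.
have [k _ /(_ k (leqnn k)) /= lam_k] := near_infty_natSinv_lt (PosNum alpha6).
have [_ _ _ [delta delta0 dK]] := KP k.
have delta2 : (0 < delta / 2)%R by rewrite divr_gt0.
have [xi [[ac1 ac2] +]] := HMxy _ delta2.
apply/negP; rewrite -ltNge.
have m1 : measurable_fun setT (fun w : path_space (borel E) * path_space (borel E) => w.1).
  exact: measurable_fst.
have m2 : measurable_fun setT (fun w : path_space (borel E) * path_space (borel E) => w.2).
  exact: measurable_snd.
(* The first marginal is absolutely continuous with respect to [Px], so it inherits this null
   event. *)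
have xi1 : xi (fst @^-1` excess (~` (K k).1) (lam k)) = 0.
  move/null_content_dominatesP : ac1; apply; first exact: measurable_excess.
  exact: (N1P _ _ PPx nx k).
have xi2 : xi (snd @^-1` excess (~` (K k).2) (lam k)) = 0.
  move/null_content_dominatesP : ac2; apply; first exact: measurable_excess.
  exact: (N2P _ _ PPy ny k).
have avg1 := average_visits_le m1 (mK1 k) (lam0 k) xi1.
have avg2 := average_visits_le m2 (mK2 k) (lam0 k) xi2.
apply: (@le_lt_trans _ _ (6 * lam k)%:E); last first.
  by rewrite lte_fin mulrC -ltr_pdivlMr.
apply: limn_esup_le_near; near=> n.
have n0 : (0 < n%:R :> R)%R by rewrite ltr0n; near: n; exact: nbhs_infty_gt.
rewrite lee_pdivrMl//.
have mp i : measurable_fun setT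
    (fun w : path_space (borel E) * path_space (borel E) => (w.1 i, w.2 i)).
  apply: measurable_fun_pair.
    exact: (measurableT_comp (measurable_coord i) m1).
  exact: (measurableT_comp (measurable_coord i) m2).
have md i : measurable [set w : path_space (borel E) * path_space (borel E) |
    (d (w.1 i) (w.2 i) <= delta / 2)%R].
  rewrite -[X in measurable X]setTI.
  exact: (mp i measurableT _ (measurable_dist_le separableE d_metric d_continuous _)).
have mc1 i : measurable [set w : path_space (borel E) * path_space (borel E) |
    (~` (K k).1) (w.1 i)].
  rewrite -[X in measurable X]setTI.
  exact: (measurableT_comp (measurable_coord i) m1).
have mc2 i : measurable [set w : path_space (borel E) * path_space (borel E) |
    (~` (K k).2) (w.2 i)].
  rewrite -[X in measurable X]setTI.
  exact: (measurableT_comp (measurable_coord i) m2).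
(* Points of [(K k).1] and [(K k).2] are at distance at least [delta], so a pair within [delta / 2]
   has a component outside its set. *)
apply: (@le_trans _ _ (\sum_(0 <= i < n) (xi [set w | (~` (K k).1) (w.1 i)] +
    xi [set w | (~` (K k).2) (w.2 i)]))).
  apply: lee_sum => i _; apply: le_trans (measureU2 _ (mc1 i) (mc2 i)).
  apply: le_measure; rewrite ?inE//; first exact: measurableU.
  move=> w /= dw; apply: contrapT => /not_orP[/contrapT K1w /contrapT K2w].
  have := dK _ _ K1w K2w; move: dw; move: (d _ _) => r; lra.
rewrite big_split/=.
have -> : n%:R%:E * (6 * lam k)%:E = (3 * lam k * n%:R)%:E + (3 * lam k * n%:R)%:E.
  by rewrite -EFinM -EFinD; congr (_%:E); ring.
by apply: leeD; near: n.
Unshelve. all: by end_near. Qed.
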